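(* Let $\mathcal{F}$ be a hypothesis class of functions from an instance space $\mathbf{X}$ to a label space $\mathbf{Y}$ and let $\mathrm{Err}$ be an error function on $\mathcal{F}$. Let $(\mathcal{L},\mathcal{O})$ be an active learning system for $\mathcal{F}$ in the query synthesis (QS) scenario, with error measure $\mathrm{Err}$, in which the learner $\mathcal{L}$ has query complexity $q_{\mathcal{L}}(\varepsilon,\delta)$. Then there exists an adversary $\mathcal{A}$ that implements an $\varepsilon$-extraction attack of complexity $q_{\mathcal{L}}(\varepsilon,\delta)$ and confidence $1-\delta$ against the class $\mathcal{F}$.
   Context: **Error function.** $\mathrm{Err}:\mathcal{F}\to\mathbb{R}$ is fixed in advance. It measures the error of a candidate $\hat f\in\mathcal{F}$ with respect to the true function $f^*\in\mathcal{F}$ held by the oracle/server, so its value may depend on $f^*$ (e.g. $\|w^*-w\|_2$ for halfspaces with normal vectors $w^*$ and $w$). **Active learning system, QS scenario.** The learner $\mathcal{L}$ is a (possibly randomized) interactive procedure. It adaptively generates arbitrary instances $x\in\mathbf{X}$ (each may depend on previous queries and answers) and sends them to the oracle. The oracle $\mathcal{O}_{f^*}$, where $f^*\in\mathcal{F}$, answers each query $x$ with the label $f^*(x)$. The learner stops according to a stopping criterion and outputs some $\hat f\in\mathcal{F}$. The pair $(\mathcal{L},\mathcal{O})$ is an active learning system for $\mathcal{F}$ in the QS scenario with query complexity $q_{\mathcal{L}}(\varepsilon,\delta)$ if, for every $f^*\in\mathcal{F}$, when $\mathcal{L}$ is allowed to interact with $\mathcal{O}_{f^*}$ using $q_{\mathcal{L}}(\varepsilon,\delta)$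 queries, it outputs $\hat f\in\mathcal{F}$ with $\mathrm{Err}(\hat f)\le\varepsilon$ with probability at least $1-\delta$. Here $\varepsilon,\delta\in(0,1)$. **Extraction experiment** $\mathrm{Exp}^{\varepsilon}_{\mathcal{F}}(S(f^* ),\mathcal{A},q)$. A server $S(f^* )$ knows $f^*\in\mathcal{F}$. An adversary $\mathcal{A}$ is given a description of $\mathcal{F}$ and oracle access to $f^*$: whenever it sends $x\in\mathbf{X}$ to the server it receives $f^*(x)$. After at most $q$ (adaptive) queries, $\mathcal{A}$ outputs $\hat f$. The output of the experiment is $1$ if $\mathrm{Err}(\hat f)\le\varepsilon$ and $0$ otherwise. **Extraction attack.** $\mathcal{A}$ implements an $\varepsilon$-extraction attack of complexity $q$ and confidence $\gamma$ against $\mathcal{F}$ if $\Pr[\mathrm{Exp}^{\varepsilon}_{\mathcal{F}}(S(f^* ),\mathcal{A},q)=1]\ge\gamma$ for every $f^*\in\mathcal{F}$, where the probability is over the randomness of $\mathcal{A}$. *)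

(* Defs.v *)
From mathcomp Require Import all_boot all_order all_algebra.
From mathcomp Require Import all_classical all_reals all_analysis measurable_realfun.

Set Implicit Arguments.
Unset Strict Implicit.
Unset Printing Implicit Defensive.
Import Order.TTheory GRing.Theory Num.Theory.
Local Open Scope classical_set_scope.
Local Open Scope ring_scope.

Inductive action (X H : Type) : Type :=
  | Query of X
  | Output of H.
Arguments Query {X H}.
Arguments Output {X H}.

(* A randomized interactive procedure that asks for labels of instances in X
   and returns a hypothesis in H. All its randomness is drawn once, as a seed;
   given the seed, the next action is an arbitrary function of the transcript
   of past (query, answer) pairs, oldest first. Choosing [Output] is the
   stopping criterion; a procedure need not ever choose it. *)
Record procedure (R : realType) (X Y H : Type) := Procedure {
  seed_display : measure_display;
  seed : measurableType seed_display;
  seed_law : probability seed R;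
  next_action : seed -> seq (X * Y) -> action X H
}.

(* The oracle, or server, holding f answers x with f x. *)
Definition answer (X Y : Type) (F : set (X -> Y)) (f : F) : X -> Y := val f.

(* [None]: the procedure asks for more than [budget] queries before stopping. *)
Fixpoint interact (X Y H : Type) (next : seq (X * Y) -> action X H)
    (ans : X -> Y) (budget : nat) (transcript : seq (X * Y)) : option H :=
  match next transcript with
  | Output f => Some f
  | Query x =>
      if budget is n.+1 then interact next ans n (rcons transcript (x, ans x))
      else None
  end.

Section ActiveLearningAndExtraction.
Variables (R : realType) (X Y : Type) (F : set (X -> Y)).
(* [Err fstar f] is the error of the candidate f when the true function is
   fstar. *)
Variable Err : F -> F -> R.

Definition outcome (A : procedure R X Y F) (fstar : F) (q : nat)
    (w : seed A) : option F :=
  interact (next_action w) (answer fstar) q [::].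

(* The error of the returned hypothesis, +oo if there is none. *)
Definition outcome_error (A : procedure R X Y F) (fstar : F) (q : nat)
    (w : seed A) : \bar R :=
  if outcome fstar q w is Some f then (Err fstar f)%:E else +oo%E.

(* The error of the returned hypothesis has to be a random variable for the
   probabilities below to make sense. *)
Definition measurable_outcome (A : procedure R X Y F) (fstar : F) (q : nat) :=
  measurable_fun [set: seed A] (@outcome_error A fstar q).

(* The learner may be tuned to the target accuracy and confidence, hence is a
   family of procedures indexed by (eps, delta). It is only required to stop
   within its query budget on the event of probability 1 - delta on which it
   succeeds. *)
Definition active_learning_system (L : R -> R -> procedure R X Y F)
    (qL : R -> R -> nat) : Prop :=
  forall eps delta : R, 0 < eps < 1 -> 0 < delta < 1 ->
  forall fstar : F,
    measurable_outcome (L eps delta) fstar (qL eps delta) /\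
    ((1 - delta)%:E <= seed_law (L eps delta)
       [set w | exists2 f : F,
          outcome fstar (qL eps delta) w = Some f & (Err fstar f <= eps)%R])%E.

(* The output bit of the extraction experiment, as a function of the
   adversary's randomness. *)
Definition extraction_experiment (eps : R) (fstar : F)
    (A : procedure R X Y F) (q : nat) (w : seed A) : bool :=
  if outcome fstar q w is Some f then Err fstar f <= eps else false.

(* Unlike a learner, an adversary of complexity q must output a hypothesis
   after at most q queries whatever its randomness. *)
Definition extraction_attack (A : procedure R X Y F) (eps : R) (q : nat)
    (gamma : R) : Prop :=
  forall fstar : F,
    [/\ forall w : seed A, exists f : F, outcome fstar q w = Some f,
        measurable_outcome A fstar q &
        (gamma%:E <= seed_law A
           [set w | extraction_experiment eps fstar q w = true])%E].

End ActiveLearningAndExtraction.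

(* Main.v *)
Require Import Defs.
From mathcomp Require Import all_boot all_order all_algebra.
From mathcomp Require Import all_classical all_reals all_analysis measurable_realfun.

Set Implicit Arguments.
Unset Strict Implicit.
Unset Printing Implicit Defensive.
Import Order.TTheory GRing.Theory Num.Theory.
Local Open Scope classical_set_scope.
Local Open Scope ring_scope.

(** The adversary runs the learner and outputs a fixed hypothesis [f0] as soon
    as the learner asks for more queries than its budget allows. The learner's
    successful runs are unaffected, and the truncated runs are exactly those
    where its error is [+oo], so the truncation is a measurable operation. *)

Definition stop_after (X Y H : Type) (q : nat) (f0 : H)
    (next : seq (X * Y) -> action X H) (t : seq (X * Y)) : action X H :=
  if next t is Query x then (if size t < q then Query x else Output f0)%N
  else next t.

(** The transcript length counts the queries already asked, so under the hypothesis the guard of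
    [stop_after] fails exactly when the remaining budget [n] is zero. *)
Lemma interact_stop_after (X Y H : Type) (q : nat) (f0 : H)
    (next : seq (X * Y) -> action X H) (ans : X -> Y) (n : nat)
    (t : seq (X * Y)) : (size t + n)%N = q ->
  interact (stop_after q f0 next) ans n t =
  Some (odflt f0 (interact next ans n t)).
Proof.
elim: n t => [|n IHn] t; rewrite /= /stop_after.
  by rewrite addn0 => ->; case: (next t) => [x|f] //; rewrite ltnn.
move=> szt; case: (next t) => [x|f] //.
(* With budget left the query goes through: the transcript gains one entry, the budget loses one,
   and their sum stays [q]. *)
by rewrite -szt -[ltnLHS]addn0 ltn_add2l /= szt IHn // size_rcons addSnnS.
Qed.

Definition truncate (R : realType) (X Y H : Type) (q : nat) (f0 : H)
    (A : procedure R X Y H) : procedure R X Y H :=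
  Procedure (seed_law A) (fun w => stop_after q f0 (next_action w)).

Section Truncation.
Variables (R : realType) (X Y : Type) (F : set (X -> Y)) (Err : F -> F -> R).

Lemma outcome_truncate (A : procedure R X Y F) (f0 fstar : F) (q : nat)
    (w : seed A) :
  outcome (A := truncate q f0 A) fstar q w = Some (odflt f0 (outcome fstar q w)).
Proof. exact: interact_stop_after. Qed.

(** As [Err] takes real values, [+oo] marks the runs without output, and the new error depends on
    the seed only through the old one. *)
Lemma outcome_error_truncate (A : procedure R X Y F) (f0 fstar : F) (q : nat)
    (w : seed A) :
  outcome_error Err (A := truncate q f0 A) fstar q w =
  if outcome_error Err fstar q w == +oo%E then (Err fstar f0)%:E
  else outcome_error Err fstar q w.
Proof.
by rewrite /outcome_error outcome_truncate; case: outcome.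
Qed.

Lemma measurable_outcome_truncate (A : procedure R X Y F) (f0 fstar : F)
    (q : nat) : measurable_outcome Err A fstar q ->
  measurable_outcome Err (truncate q f0 A) fstar q.
Proof.
move=> mA; rewrite /measurable_outcome.
rewrite (funext (@outcome_error_truncate A f0 fstar q)).
apply: measurable_fun_ifT => //.
(* It remains to see that the test is measurable: it holds on the preimage of a singleton. *)
apply: (measurable_fun_bool true).
rewrite [X in measurable X](_ : _ =
    setT `&` outcome_error Err (A := A) fstar q @^-1` [set +oo%E]).
  exact: (mA measurableT _ (emeasurable_set1 _)).
by apply/seteqP; split=> w [_ /= /eqP].
Qed.

(** The default [false] agrees with [+oo] exceeding [eps], so success is a sublevel set of the
    error. *)
Lemma extraction_experimentE (A : procedure R X Y F) (eps : R) (fstar : F)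
    (q : nat) (w : seed A) :
  extraction_experiment Err eps fstar q w =
  (outcome_error Err fstar q w <= eps%:E)%E.
Proof.
by rewrite /extraction_experiment /outcome_error; case: outcome.
Qed.

Lemma measurable_extraction_experiment (A : procedure R X Y F) (eps : R)
    (fstar : F) (q : nat) : measurable_outcome Err A fstar q ->
  measurable [set w : seed A | extraction_experiment Err eps fstar q w = true].
Proof.
move=> mA.
under eq_set do rewrite extraction_experimentE.
by rewrite -[X in measurable X]setTI; exact: emeasurable_fun_infty_c.
Qed.

Lemma extraction_experimentP (A : procedure R X Y F) (eps : R) (fstar : F)
    (q : nat) (w : seed A) :
  (extraction_experiment Err eps fstar q w = true) =
  exists2 f : F, outcome fstar q w = Some f & Err fstar f <= eps.
Proof.
apply/propext; rewrite /extraction_experiment; case: outcome => [f|].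
  by split=> [|[_ [<-]]]//; exists f.
by split=> // -[].
Qed.

(** Only an implication: on a truncated run [f0] may happen to be accurate. *)
Lemma extraction_experiment_truncate (A : procedure R X Y F) (f0 fstar : F)
    (eps : R) (q : nat) (w : seed A) :
  extraction_experiment Err eps fstar q w ->
  extraction_experiment Err (A := truncate q f0 A) eps fstar q w.
Proof.
by rewrite /extraction_experiment outcome_truncate; case: outcome.
Qed.

End Truncation.

Theorem mainTheorem1 (R : realType) (X Y : Type) (F : set (X -> Y))
    (Err : F -> F -> R) (L : R -> R -> procedure R X Y F)
    (qL : R -> R -> nat) :
  active_learning_system Err L qL ->
  forall eps delta : R, 0 < eps < 1 -> 0 < delta < 1 ->
  exists A : procedure R X Y F,
    extraction_attack Err A eps (qL eps delta) (1 - delta).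
Proof.
move=> learns eps delta eps01 delta01.
(* The fallback [f0] is chosen before [fstar], on which the adversary must not depend. If [F] is
   empty, any procedure is vacuously an attack. *)
have [[f0]|noF] := pselect (inhabited F); last first.
  by exists (L eps delta) => fstar; case: noF.
exists (truncate (qL eps delta) f0 (L eps delta)) => fstar.
have [mL succL] := learns _ _ eps01 delta01 fstar.
have mA := measurable_outcome_truncate (f0 := f0) mL.
split=> // [w|]; first by eexists; exact: outcome_truncate.
apply: (le_trans succL).
under eq_set do rewrite -extraction_experimentP.
(* Monotonicity of the measure needs both success events measurable, besides their inclusion. *)
apply: le_measure; rewrite ?inE; [| |move=> w].
- exact: measurable_extraction_experiment.
- exact: (measurable_extraction_experiment eps mA).
- exact: extraction_experiment_truncate.
Qed.
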